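(* Let $n\ge 2$ be an integer, let $S_n$ be the set of all permutations of $[n]=\{1,\dots,n\}$, and let $\mathcal{Q}^*_n$ be the family of all maximum-cardinality minimal inversion-complete subsets of $S_n$. Then: (i) The maximum cardinality of a minimal inversion-complete subset of $S_n$ is $\gamma_I(n)=\lfloor n^2/4\rfloor$. (ii) For every even $n\ge 4$, there is a family of $n^2/4$ pairwise disjoint subsets of $S_n$, each of cardinality $\left[\left(\frac n2-1\right)!\right]^2$, such that $\mathcal{Q}^*_n$ is exactly the family of all transversals of this family; consequently $|\mathcal{Q}^*_n|=\left[\left(\frac n2-1\right)!\right]^{n^2/2}$. (iii) For every odd $n\ge 5$, there are two families, each consisting of $\lfloor n^2/4\rfloor$ pairwise disjoint subsets of $S_n$ of cardinality $\left(\lfloor\frac n2\rfloor-1\right)!\,\lfloor\frac n2\rfloor!$, such that $\mathcal{Q}^*_n$ is the disjoint union of the family of all transversals of the first and the family of all transversals of the second; consequently $|\mathcal{Q}^*_n|=2\left[\left(\lfloor\frac n2\rfloor-1\right)!\,\lfloor\frac n2\rfloor!\right]^{\lfloor n^2/4\rfloor}$.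
   Context: Permutations $\pi\in S_n$ are written as sequences $(\pi(1),\dots,\pi(n))$. A permutation $\pi$ covers the ordered pair $(\pi(k),\pi(l))$ (with distinct entries) iff $k<l$, i.e. $\pi(k)$ appears before $\pi(l)$. An inversion is an ordered pair $(j,i)$ with $1\le i<j\le n$. A set $Q\subseteq S_n$ is inversion-complete if every inversion is covered by at least one permutation in $Q$; it is minimally inversion-complete if moreover no proper subset of $Q$ is inversion-complete. A transversal of a collection $\mathcal{F}$ of sets is a set containing exactly one element from each member of $\mathcal{F}$. *)

(* Defs.v *)
From mathcomp Require Import all_boot perm.

Set Implicit Arguments.
Unset Strict Implicit.
Unset Printing Implicit Defensive.

(* [n] is represented by 'I_n = {0, ..., n-1}: positions and entries are both
   shifted down by one, which does not affect any of the order relations. *)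

Definition covers n (p : 'S_n) (a b : 'I_n) : bool :=
  [exists k : 'I_n, exists l : 'I_n, [&& k < l, p k == a & p l == b]].

Definition inversion_complete n (Q : {set 'S_n}) : bool :=
  [forall i : 'I_n, forall j : 'I_n,
    (i < j) ==> [exists p in Q, covers p j i]].

Definition min_inversion_complete n (Q : {set 'S_n}) : bool :=
  inversion_complete Q &&
  [forall R : {set 'S_n}, (R \proper Q) ==> ~~ inversion_complete R].

Definition gammaI n : nat :=
  \max_(Q : {set 'S_n} | min_inversion_complete Q) #|Q|.

Definition Qstar n : {set {set 'S_n}} :=
  [set Q : {set 'S_n} | min_inversion_complete Q & #|Q| == gammaI n].

(* A transversal has no elements outside the union of F. [is_transversal] also
   requires F to be a partition of that union, i.e. its members to be pairwise
   disjoint and nonempty. *)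
Definition transversals (T : finType) (F : {set {set T}}) : {set {set T}} :=
  [set X : {set T} | is_transversal X F (cover F)].

(* Main.v *)
Require Import Defs.
From mathcomp Require Import all_boot fingroup perm action.
From mathcomp Require Import zify.

(* Every member of a minimal inversion-complete set [Q] covers some inversion
   that no other member covers; choose one such private inversion for each
   member and view it as an edge on the entries.  A permutation covering (z, x)
   with x < y < z also covers (y, x) or (z, y), so this graph is triangle-free
   and Mantel's theorem gives the bound [n ^ 2 %/ 4].  In the equality case the
   graph is a balanced complete bipartite graph.  Each member of [Q] then keeps
   all pairs across the bipartition, except its private one, in natural order;
   this and the completeness of [Q] force one side to be an initial segment
   {x | x < k} with [k] one of the two halves of [n].  So the member of [Q] with
   private inversion (j, i) lists the entries below [k] other than [i] in some
   order, then [j], [i], then the remaining entries in some order.  Conversely,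
   any choice of one such permutation for each i < k <= j is a minimal
   inversion-complete set. *)

Set Implicit Arguments.
Unset Strict Implicit.
Unset Printing Implicit Defensive.

(** * Mantel's theorem and its equality case *)

Section Mantel.

Variables (T : finType) (e : rel T).
Hypotheses (e_sym : symmetric e)
  (e_triangle_free : forall x y z, e x y -> e y z -> ~~ e x z).

(** Ordered pairs are counted, so [edges setT setT] is twice the number of edges; hence the factor 2
    in [mantel] and [mantel_eq]. *)
Let edges (A B : {set T}) := \sum_(x in A) \sum_(y in B) (e x y : nat).

Let edgesC A B : edges A B = edges B A.
Proof.
by rewrite /edges exchange_big; do 2!apply: eq_bigr => ? _; rewrite e_sym.
Qed.

Let edges_splitr A B : edges A [set: T] = edges A B + edges A (~: B).
Proof.
rewrite /edges -big_split; apply: eq_bigr => x _ /=.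
rewrite (bigID (mem B)) /=; congr (_ + _).
  by apply: eq_bigl => y; rewrite inE.
by apply: eq_bigl => y; rewrite !inE.
Qed.

Let edges_setT : #|[set u | e u.1 u.2]| = edges setT setT.
Proof.
rewrite -sum1_card /edges pair_big /= big_mkcond [RHS]big_mkcond /=.
by apply: eq_bigr => u _; rewrite !inE /=; case: (e _ _).
Qed.

Let neighbours x := [set y | e x y].

Let edges_eq0 A B x y : edges A B = 0 -> x \in A -> y \in B -> ~~ e x y.
Proof.
move/eqP; rewrite sum_nat_eq0 => /forall_inP AB0 xA yB.
have := AB0 x xA; rewrite sum_nat_eq0 => /forall_inP/(_ y yB).
by case: (e x y).
Qed.

(** Joined and unjoined pairs together number [#|A| * #|B|], so attaining this value leaves no
    unjoined pair. *)
Let edges_max A B x y : edges A B = #|A| * #|B| -> x \in A -> y \in B -> e x y.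
Proof.
move=> ABmax xA yB; apply: contraT => exy.
have : edges A B + \sum_(x in A) \sum_(y in B) (~~ e x y : nat) = #|A| * #|B|.
  rewrite -big_split -sum_nat_const; apply: eq_bigr => u _ /=.
  by rewrite -big_split -sum1_card; apply: eq_bigr => v _ /=; case: (e u v).
rewrite ABmax (bigD1 x) //= (bigD1 y) //= exy; lia.
Qed.

(* Let [N] be the neighbourhood of a vertex of maximum degree [D].  It is
   independent, so every edge has an end in the complement of [N], whence at
   most [(#|T| - D) * D] edges. *)
Let mantel_split : 0 < #|T| -> exists N : {set T},
  edges N N = 0 /\ edges (~: N) setT <= #|~: N| * #|N|.
Proof.
move=> T_gt0; have [v vE] := eq_bigmax (fun y => #|neighbours y|) T_gt0.
exists (neighbours v); split.
  apply/eqP; rewrite sum_nat_eq0; apply/forall_inP => x; rewrite inE => vx.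
  rewrite sum_nat_eq0; apply/forall_inP => y; rewrite inE => vy.
  by rewrite eqb0 (@e_triangle_free x v y) // e_sym.
rewrite -sum_nat_const /edges; apply: leq_sum => x _; rewrite -vE.
apply: leq_trans (@leq_bigmax _ (fun y => #|neighbours y|) x).
rewrite -sum1_card [leqRHS]big_mkcond /= [leqLHS]big_mkcond /=.
by apply: leq_sum => y _; rewrite !inE; case: (e _ _).
Qed.

(** Degrees summed over the complement of the independent set [N] count a crossing edge once and an
    edge inside the complement twice. The surplus [edges (~: N) (~: N)] has to vanish in the
    equality case. *)
Let edges_split N : edges N N = 0 -> edges setT setT + edges (~: N) (~: N) =
  2 * edges (~: N) setT.
Proof.
move=> NN; rewrite (edges_splitr setT N) 2!(edgesC setT) (edges_splitr N N).
rewrite (edges_splitr (~: N) N) NN (edgesC N); lia.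
Qed.

Let mul_le_quarter_sqr a b c : a + b = c -> a * b <= c ^ 2 %/ 4.
Proof. by move=> <-; rewrite leq_divRL // mulnC; have [] := nat_AGM2 a b. Qed.

Lemma mantel : 0 < #|T| -> #|[set u | e u.1 u.2]| <= 2 * (#|T| ^ 2 %/ 4).
Proof.
move=> /mantel_split[N [NN leN]]; rewrite edges_setT.
have := mul_le_quarter_sqr (cardsC N); have := edges_split NN; nia.
Qed.

(** Every inequality in the proof of [mantel] becomes tight: no edge lies inside [~: N], all pairs
    between [~: N] and [N] are edges, and the two sizes have maximal product. *)
Lemma mantel_eq : 0 < #|T| ->
  #|[set u | e u.1 u.2]| = 2 * (#|T| ^ 2 %/ 4) ->
  exists N : {set T}, #|N| * #|~: N| = #|T| ^ 2 %/ 4 /\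
    forall x y, e x y = ((x \in N) != (y \in N)).
Proof.
move=> /mantel_split[N [NN leN]]; rewrite edges_setT => maxT; exists N.
have le_quarter := mul_le_quarter_sqr (cardsC N).
have splitT := edges_split NN; have splitC := edges_splitr (~: N) N.
have CC : edges (~: N) (~: N) = 0 by nia.
have CN : edges (~: N) N = #|~: N| * #|N| by nia.
split=> [|x y]; first by nia.
have [xN | xN] := boolP (x \in N); have [yN | yN] := boolP (y \in N).
- by apply: negbTE; apply: edges_eq0 NN _ _.
- by rewrite e_sym; apply: edges_max CN _ _; rewrite ?inE.
- by apply: edges_max CN _ _; rewrite ?inE.
- by apply: negbTE; apply: edges_eq0 CC _ _; rewrite inE.
Qed.

End Mantel.

(** * Counting transversals *)

Lemma card_transversals (T : finType) (x0 : T) (F : {set {set T}}) (m : nat) :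
  0 < m -> trivIset F -> (forall B, B \in F -> #|B| = m) ->
  #|transversals F| = m ^ #|F|.
Proof.
move=> m_gt0 tiF cardF.
have F0 : set0 \notin F.
  by apply/negP => /cardF m0; rewrite -m0 cards0 in m_gt0.
have partF : partition F (cover F) by rewrite /partition eqxx tiF.
(* Transversals correspond to choice functions on [F], made unique by the fixed value [x0] outside
   [F]. *)
have -> : m ^ #|F| = #|pfamily x0 F (fun B : {set T} => B)|.
  rewrite card_pfamily /image_mem cardE.
  have : {subset enum F <= F} by move=> B; rewrite mem_enum.
  elim: (enum F) => //= B s IHs sF; rewrite expnS IHs; last first.
    by move=> C Cs; apply: sF; rewrite inE Cs orbT.
  by rewrite cardF // sF ?mem_head.
have choice_inj : {in pfamily x0 F (fun B : {set T} => B) &,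
    injective (fun f : {ffun {set T} -> T} => [set f B | B in F])}.
  move=> f g /pfamilyP[/supportP suppf ff] /pfamilyP[/supportP suppg fg] fgE.
  apply/ffunP => B; have [BF | BF] := boolP (B \in F); last by rewrite suppf ?suppg.
  (* The point [f B = g C] lies in both [B] and [C], so disjointness forces [C = B]. *)
  have : f B \in [set g B | B in F] by rewrite -fgE imset_f.
  case/imsetP => C CF fBgC; rewrite fBgC; congr (g _); apply: esym.
  rewrite -(def_pblock tiF BF (ff _ BF)) fBgC.
  exact: def_pblock tiF CF (fg _ CF).
rewrite -(card_in_imset choice_inj); apply: eq_card => X; rewrite inE.
apply/idP/imsetP => [trX | [f /pfamilyP[_ ff] ->]].
  exists [ffun B => if B \in F then transversal_repr x0 X B else x0].
    apply/pfamilyP; split=> [|B BF]; last first.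
      by rewrite ffunE BF (repr_mem_pblock trX).
    by apply/supportP => B /negPf BF; rewrite ffunE BF.
  rewrite -{1}(im_transversal_repr trX x0).
  by apply: eq_in_imset => B BF; rewrite ffunE BF.
apply/and3P; split=> //.
  by apply/subsetP => _ /imsetP[B BF ->]; apply/bigcupP; exists B; rewrite ?ff.
apply/forall_inP => B BF; apply/cards1P; exists (f B); apply/setP => y.
rewrite !inE; apply/andP/eqP => [[/imsetP[C CF ->] fCB] | ->].
  by rewrite -(def_pblock tiF BF fCB) (def_pblock tiF CF (ff _ CF)).
by rewrite imset_f ?ff.
Qed.

(** * Covering in terms of positions, given by [p^-1], and auxiliary facts on permutations *)

Lemma coversE n (p : 'S_n) (a b : 'I_n) : covers p a b = ((p^-1)%g a < (p^-1)%g b).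
Proof.
apply/existsP/idP => [[x /existsP[y /and3P[xy /eqP<- /eqP<-]]] | ab].
  by rewrite !permK.
by exists ((p^-1)%g a); apply/existsP; exists ((p^-1)%g b); rewrite ab !permKV !eqxx.
Qed.

Lemma covers_trans n (p : 'S_n) : transitive (covers p).
Proof. by move=> b a c; rewrite !coversE; apply: ltn_trans. Qed.

Lemma coversN n (p : 'S_n) (a b : 'I_n) : a != b -> ~~ covers p a b = covers p b a.
Proof.
rewrite -(inj_eq (@perm_inj _ p^-1%g)) -val_eqE !coversE /=; lia.
Qed.

Lemma coversF n (p : 'S_n) (a b : 'I_n) : covers p a b -> covers p b a = false.
Proof. by rewrite !coversE => /ltnW; rewrite leqNgt => /negbTE. Qed.

(** The factor on [A] is the restriction of [s] to [A]; dividing it out leaves a permutation moving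
    only points of [B]. *)
Lemma perm_on_prodP (T : finType) (A B : {set T}) (s : {perm T}) :
  {in A, forall x, s x \in A} -> {in ~: (A :|: B), forall x, s x = x} ->
  [disjoint A & B] -> s \in (Sym A * Sym B)%g.
Proof.
move=> sA sAB disAB.
have nAs : s \in 'N(A | 'P)%g.
  by rewrite !inE /=; apply/subsetP => x xA; rewrite inE apermE sA.
have onA := restr_perm_on A s.
apply/imset2P; exists (restr_perm A s) ((restr_perm A s)^-1 * s)%g.
- by rewrite inE.
- rewrite inE; apply/subsetP => x; rewrite inE permM; apply: contraR => xB.
  apply/eqP; have [xA | xA] := boolP (x \in A).
    have yA : (restr_perm A s)^-1%g x \in A by rewrite (perm_closed _ (perm_onV onA)).
    by rewrite -(restr_permE nAs yA) permKV.
  by rewrite (out_perm (perm_onV onA)) // sAB // !inE negb_or xA.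
- by rewrite mulKVg.
Qed.

Lemma card_ord_lt n m : m <= n -> #|[set x : 'I_n | x < m]| = m.
Proof.
move=> le_mn; rewrite -sum1dep_card -(big_ord_widen n (fun=> 1) le_mn).
by rewrite sum1_card card_ord.
Qed.

(** Recovers the position of an entry from the set of entries before it; used to compare members of
    one block. *)
Lemma card_covers n (p : 'S_n) (a : 'I_n) : #|[set x | covers p x a]| = (p^-1)%g a.
Proof.
rewrite -[RHS](card_ord_lt (ltnW (ltn_ord _))).
rewrite -[RHS](card_preimset _ (@perm_inj _ p^-1%g)).
by apply: eq_card => x; rewrite !inE coversE.
Qed.

(** * The blocks of permutations attached to a cut [k] of the entries *)

Section Blocks.

Variables (n k : nat).
Implicit Types (p s : 'S_n) (a b i j x y : 'I_n).

(** For [i < k <= j], these are the permutations whose only inversion across the cut is [(j, i)]. *)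
Definition block i j : {set 'S_n} :=
  [set p : 'S_n | [forall a : 'I_n, forall b : 'I_n,
     (a < k <= b) ==> (covers p b a == ((a, b) == (i, j)))]].

Definition cross : {set 'I_n * 'I_n} := [set u : 'I_n * 'I_n | u.1 < k <= u.2].

Definition blocks : {set {set 'S_n}} := [set block u.1 u.2 | u in cross].

Lemma in_cross u : (u \in cross) = (u.1 < k <= u.2).
Proof. by rewrite inE. Qed.

Lemma blockP i j p :
  reflect (forall a b, a < k -> k <= b -> covers p b a = ((a, b) == (i, j)))
          (p \in block i j).
Proof.
rewrite inE; apply: (iffP forallP) => [pij a b ak kb | pij a].
  by have /forallP/(_ b) := pij a; rewrite ak kb => /eqP.
by apply/forallP => b; apply/implyP => /andP[ak kb]; rewrite pij.
Qed.

Section OneBlock.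

Variables i j : 'I_n.
Hypotheses (ik : i < k) (kj : k <= j).

Let low := [set x : 'I_n | (x < k) && (x != i)].
Let high := [set x : 'I_n | (k <= x) && (x != j)].

Lemma block_covers p : p \in block i j -> covers p j i.
Proof. by move/blockP->; rewrite ?eqxx. Qed.

(** An entry below [k] other than [i] is not inverted with [j], so it precedes [j]. An entry
    [x >= k] before [j] would also precede [i], giving a second inversion across the cut. *)
Lemma block_lt_high p : p \in block i j -> [set x | covers p x j] = low.
Proof.
move=> pij; have /blockP pE := pij; apply/setP => x; rewrite !inE.
have [xk | kx] /= := ltnP x k.
  have jx : j != x by apply: contraTneq xk => <-; rewrite -leqNgt.
  by rewrite -(coversN p jx) pE // xpair_eqE eqxx andbT.
apply: negbTE; apply/negP => xj.
have := covers_trans xj (block_covers pij).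
rewrite pE // xpair_eqE eqxx /= => /eqP xE.
by rewrite xE coversE ltnn in xj.
Qed.

Lemma block_lt_low p : p \in block i j -> [set x | covers p x i] = j |: low.
Proof.
move=> pij; have /blockP pE := pij; apply/setP => x; rewrite !inE.
have [-> | xj] := eqVneq x j; first by rewrite block_covers.
have [xk | kx] /= := ltnP x k; last first.
  by rewrite pE // xpair_eqE (negPf xj) andbF.
have [-> | xi] /= := eqVneq x i; first by rewrite coversE ltnn.
apply: covers_trans (block_covers pij).
by have := block_lt_high pij; move/setP/(_ x); rewrite !inE xk xi.
Qed.

Lemma card_low : #|low| = k.-1.
Proof.
have := card_ord_lt (leq_trans kj (ltnW (ltn_ord j))).
rewrite (cardsD1 i) inE ik => <- /=.
by apply: eq_card => x; rewrite !inE andbC.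
Qed.

Lemma card_high : #|high| = (n - k).-1.
Proof.
have := cardsC [set x : 'I_n | x < k]; rewrite card_ord.
rewrite card_ord_lt ?(leq_trans kj (ltnW (ltn_ord j))) //.
rewrite (cardsD1 j) !inE -leqNgt kj.
have -> : #|~: [set x : 'I_n | x < k] :\ j| = #|high|; last by lia.
by apply: eq_card => x; rewrite !inE -leqNgt andbC.
Qed.

Let low_high_disjoint : [disjoint low & high].
Proof.
by rewrite disjoint_subset; apply/subsetP => x; rewrite !inE; case: ltnP.
Qed.

Lemma Sym_low_high s : s \in (Sym low * Sym high)%g ->
  [/\ s i = i, s j = j & forall x, (s x < k) = (x < k)].
Proof.
case/imset2P => t u; rewrite !inE => tlow uhigh ->.
have tP x : (t x < k) = (x < k).
  have [xl | xl] := boolP (x \in low); last by rewrite (out_perm tlow).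
  have : t x \in low by rewrite (perm_closed _ tlow).
  by move: xl; rewrite !inE => /andP[-> _] /andP[-> _].
have uP x : (u x < k) = (x < k).
  have [xl | xl] := boolP (x \in high); last by rewrite (out_perm uhigh).
  have : u x \in high by rewrite (perm_closed _ uhigh).
  by move: xl; rewrite !inE !ltnNge => /andP[-> _] /andP[-> _].
split=> [||x]; last by rewrite permM uP tP.
  by rewrite permM (out_perm tlow) ?(out_perm uhigh) // !inE ?eqxx ?andbF // leqNgt ik.
by rewrite permM (out_perm tlow) ?(out_perm uhigh) // !inE ?eqxx ?andbF // ltnNge kj.
Qed.

(** Right factors act on entries. Two members of the block agree on the positions of [i] and [j] and
    on the set of entries before [j], so they differ by permuting [low] and [high] separately.
    Conversely, such a relabelling fixes [i] and [j] and respects the cut. *)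
Lemma block_lcoset p : p \in block i j -> block i j = (p *: (Sym low * Sym high))%g.
Proof.
move=> pij; apply/setP => q; rewrite mem_lcoset; apply/idP/idP => [qij | sP].
  have pjE : (p^-1)%g j = (q^-1)%g j.
    by apply: val_inj; rewrite /= -!card_covers !block_lt_high.
  have piE : (p^-1)%g i = (q^-1)%g i.
    by apply: val_inj; rewrite /= -!card_covers !block_lt_low.
  apply: perm_on_prodP => [x|x|//].
    rewrite -{1}(block_lt_high pij) -(block_lt_high qij) !inE !coversE pjE.
    by rewrite permM permK.
  rewrite !inE permM.
  have [-> _ | xi] := eqVneq x i; first by rewrite piE permKV.
  have [-> _ | xj] := eqVneq x j; first by rewrite pjE permKV.
  by rewrite /= !andbT; case: ltnP.
have [s [qE si sj sk]] : exists s,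
    [/\ q = (p * s)%g, s i = i, s j = j & forall x, (s x < k) = (x < k)].
  by have [si sj sk] := Sym_low_high sP; exists (p^-1 * q)%g; rewrite mulKVg.
have /blockP pE := pij; apply/blockP => a b ak kb.
have <- : covers p ((s^-1)%g b) ((s^-1)%g a) = covers q b a.
  by rewrite !coversE qE invMg !permM.
have sVk x : ((s^-1)%g x < k) = (x < k) by rewrite -sk permKV.
rewrite pE ?sVk // 1?leqNgt ?sVk -?leqNgt //.
by rewrite !xpair_eqE -!(inj_eq (@perm_inj _ s) ((s^-1)%g _)) !permKV si sj.
Qed.

Lemma block_nonempty : exists p, p \in block i j.
Proof.
have kn : k < n := leq_ltn_trans kj (ltn_ord j).
have k1n : k.-1 < n by lia.
pose k0 := Ordinal kn; pose k1 := Ordinal k1n.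
(* Exchange the entries [k - 1] and [k] of the identity, then relabel [k - 1] as [i] and [k] as [j]:
   now [j] has position [k - 1] and [i] has position [k]. All other entries below [k] come earlier
   and all others from [k] on come later, as the four cases check. *)
exists (tperm k1 k0 * tperm k1 i * tperm k0 j)%g; apply/blockP => a b ak kb.
rewrite coversE !invMg !tpermV !permM xpair_eqE.
have tlow : tperm k0 j a = a by rewrite tpermD // -val_eqE /=; lia.
have thigh (c : 'I_n) : k <= c -> tperm k1 i c = c.
  by move=> kc; rewrite tpermD // -val_eqE /=; lia.
have [ai | ai] := eqVneq a i; have [bj | bj] := eqVneq b j => /=.
- rewrite ai bj in tlow *; rewrite tlow !tpermR tpermL thigh //= tpermR /=; lia.
- have : k < tperm k0 j b.
    case: tpermP bj => [->|->|/eqP]; rewrite -?val_eqE /= ?eqxx //; lia.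
  move: (tperm k0 j b) => c kc; rewrite thigh ?(ltnW kc) //.
  rewrite ai in tlow *; rewrite tlow tpermR tpermL [tperm _ _ c]tpermD -?val_eqE /=; lia.
- have : tperm k1 i a < k.-1.
    case: tpermP ai => [->|->|/eqP]; rewrite -?val_eqE /= ?eqxx //; lia.
  rewrite tlow bj tpermR (thigh k0) //= tpermR.
  move: (tperm k1 i a) => c ck; rewrite tpermD -?val_eqE /=; lia.
- have : k < tperm k0 j b.
    case: tpermP bj => [->|->|/eqP]; rewrite -?val_eqE /= ?eqxx //; lia.
  move: (tperm k0 j b) => d kd; rewrite tlow thigh ?(ltnW kd) //.
  have : tperm k1 i a < k.-1.
    case: tpermP ai => [->|->|/eqP]; rewrite -?val_eqE /= ?eqxx //; lia.
  move: (tperm k1 i a) => c ck.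
  rewrite [tperm _ _ c]tpermD -?val_eqE /= ?[tperm _ _ d]tpermD -?val_eqE /=; lia.
Qed.

Lemma card_block : #|block i j| = k.-1`! * (n - k).-1`!.
Proof.
have [p pij] := block_nonempty.
rewrite (block_lcoset pij) card_lcoset TI_cardMg ?card_Sym ?card_low ?card_high //.
apply/trivgP/subsetP => s; rewrite !inE => /andP[slow shigh].
apply/eqP/permP => x; rewrite perm1.
have [xl | xl] := boolP (x \in low); last by rewrite (out_perm slow).
by rewrite (out_perm shigh) // (disjointFr low_high_disjoint xl).
Qed.

End OneBlock.

(** The pair [u] can be read off [p] as its only inversion across the cut. *)
Lemma block_unique u v p : u \in cross -> v \in cross ->
  p \in block u.1 u.2 -> p \in block v.1 v.2 -> u = v.
Proof.
case: u v => [i j] [i' j']; rewrite !in_cross /= => /andP[ik kj] /andP[ik' kj'].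
by move=> /blockP pE /(block_covers ik' kj'); rewrite pE // => /eqP.
Qed.

Lemma blocksP u : u \in cross -> block u.1 u.2 \in blocks.
Proof. exact: imset_f. Qed.

Lemma block_inhabited u : u \in cross -> exists p, p \in block u.1 u.2.
Proof. by case: u => i j; rewrite inE => /andP[]; apply: block_nonempty. Qed.

Lemma trivIset_blocks : trivIset blocks.
Proof.
apply/trivIsetP => _ _ /imsetP[u uC ->] /imsetP[v vC ->] uv.
rewrite -setI_eq0; apply: contra_neqT uv => /set0Pn[p /setIP[pu pv]].
by rewrite (block_unique uC vC pu pv).
Qed.

Lemma card_in_blocks B : B \in blocks -> #|B| = k.-1`! * (n - k).-1`!.
Proof.
by case/imsetP => -[i j]; rewrite inE => /andP[ik kj] ->; apply: card_block.
Qed.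

Lemma partition_blocks : partition blocks (cover blocks).
Proof.
rewrite /partition eqxx trivIset_blocks; apply/imsetP => -[u uC /esym/eqP].
by have [p pu] := block_inhabited uC; apply/negP/set0Pn; exists p.
Qed.

Lemma card_blocks : k <= n -> #|blocks| = k * (n - k).
Proof.
move=> kn; rewrite card_in_imset => [|u v uC vC /= uvE]; last first.
  have [p pu] := block_inhabited uC.
  have pv : p \in block v.1 v.2 by rewrite -uvE.
  exact: block_unique uC vC pu pv.
have -> : cross = setX [set x : 'I_n | x < k] (~: [set x : 'I_n | x < k]).
  by apply/setP => -[a b]; rewrite !inE /= -leqNgt.
have := cardsC [set x : 'I_n | x < k].
by rewrite cardsX card_ord card_ord_lt // => nE; congr (_ * _); lia.
Qed.

(** * Transversals of the blocks are minimal inversion-complete *)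

Section Transversal.

Variable X : {set 'S_n}.
Hypothesis trX : X \in transversals blocks.

Let trX' : is_transversal X blocks (cover blocks).
Proof. by have := trX; rewrite inE. Qed.

Lemma transversal_meets u : u \in cross -> exists2 p, p \in X & p \in block u.1 u.2.
Proof.
move=> uC; exists (transversal_repr 1%g X (block u.1 u.2)).
  exact: repr_mem_transversal trX' _ _ (blocksP uC).
exact: repr_mem_pblock trX' _ _ (blocksP uC).
Qed.

Lemma transversal_in_block p : p \in X -> exists2 u, u \in cross & p \in block u.1 u.2.
Proof.
move/(subsetP (transversal_sub trX')).
by case/bigcupP => _ /imsetP[u uC ->]; exists u.
Qed.

Lemma transversal_block_unique u p q : u \in cross -> p \in X -> q \in X ->
  p \in block u.1 u.2 -> q \in block u.1 u.2 -> p = q.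
Proof.
move=> uC pX qX pu qu; apply: (pblock_inj trX' pX qX).
by rewrite !(def_pblock trivIset_blocks (blocksP uC)).
Qed.

(** An inversion across the cut is covered by the member from its own block and by no other member,
    which gives minimality. Inversions on one side of the cut are covered through a suitable entry
    of the other side. *)
Lemma transversal_min_inversion_complete : 0 < k < n -> min_inversion_complete X.
Proof.
case/andP => k_gt0 kn; apply/andP; split.
  apply/forallP => i; apply/forallP => j; apply/implyP => ij; apply/exists_inP.
  have [jk | kj] := ltnP j k.
    have ik := ltn_trans ij jk.
    (* Both entries lie below [k]: in the block of [(i, k)], [j] precedes [k] and [k] precedes
       [i]. *)
    have uC : (i, Ordinal kn) \in cross by rewrite in_cross /= ik leqnn.
    have [p pX /= pb] := transversal_meets uC.
    exists p => //; apply: (covers_trans _ (block_covers ik _ pb)) => //.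
    have /setP/(_ j) := block_lt_high ik (leqnn k : k <= Ordinal kn) pb.
    by rewrite !inE jk -val_eqE /= => ->; lia.
  have [ik | ki] := ltnP i k.
    have uC : (i, j) \in cross by rewrite in_cross /= ik.
    have [p pX /= pb] := transversal_meets uC.
    by exists p => //; apply: block_covers pb.
  (* Both entries are at least [k]: in the block of [(0, j)], [j] precedes 0 and 0 precedes [i]. *)
  pose l : 'I_n := Ordinal (ltn_trans k_gt0 kn).
  have uC : (l, j) \in cross by rewrite in_cross /= k_gt0.
  have [p pX /= pb] := transversal_meets uC.
  exists p => //; apply: (covers_trans (block_covers _ kj pb)) => //=.
  have /blockP pE := pb; rewrite -coversN -?val_eqE /=; last by lia.
  by rewrite pE //= xpair_eqE eqxx /= -val_eqE /=; lia.
apply/forallP => R; apply/implyP => /properP[RX [p pX pR]].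
have [u uC pu] := transversal_in_block pX.
apply/negP => /forallP/(_ u.1)/forallP/(_ u.2).
have /andP[u1 u2] : u.1 < k <= u.2 by rewrite inE in uC.
rewrite (leq_trans u1 u2) /= => /exists_inP[q qR qu].
have qX := subsetP RX q qR; have [v vC qv] := transversal_in_block qX.
have /blockP qE := qv; rewrite qE // in qu.
have uv : u = v by case: (u) (v) qu => [? ?] [? ?] /eqP.
rewrite -uv in qv.
by rewrite (transversal_block_unique uC pX qX pu qv) qR in pR.
Qed.

End Transversal.

Lemma transversals_blocks_inhabited : exists X, X \in transversals blocks.
Proof.
by exists (transversal blocks (cover blocks)); rewrite inE transversalP ?partition_blocks.
Qed.

End Blocks.

(** In fact no permutation lies in a block for [k] and in one for [k.+1]. The entry [m = k] is on
    the upper side of the first cut and on the lower side of the second. *)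
Lemma transversals_blocksS_disjoint n k : 0 < k -> k.+1 < n ->
  [disjoint transversals (@blocks n k) & transversals (@blocks n k.+1)].
Proof.
move=> k_gt0 kn; rewrite disjoint_subset; apply/subsetP => X X1; rewrite inE.
apply/negP => X2; have kn' := ltnW kn.
pose m : 'I_n := Ordinal kn'.
have uC : (Ordinal (ltn_trans k_gt0 kn'), m) \in cross n k.
  by rewrite in_cross /= k_gt0 leqnn.
have [p pX _] := transversal_meets X1 uC.
have [[i j] /= + pij] := transversal_in_block X1 pX.
have [[i' j'] /= + pij'] := transversal_in_block X2 pX.
rewrite !in_cross /= => /andP[ik' kj'] /andP[ik kj].
have ji := block_covers ik kj pij; have ji' := block_covers ik' kj' pij'.
have /blockP pE := pij; have /blockP pE' := pij'.
(* If [j = m], either [j'] precedes [m] and hence [i], or [(j', i')] already crosses the first cut;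
   both give an inversion across it other than [(m, i)]. *)
have [jm | jm] := eqVneq j m.
  have [im' | im'] := eqVneq i' m.
    rewrite im' -jm in ji'; have := covers_trans ji' ji.
    rewrite pE //; last exact: ltnW.
    by rewrite jm xpair_eqE -!val_eqE /=; lia.
  have ik1' : i' < k by move: im'; rewrite -val_eqE /=; lia.
  have := ji'; rewrite pE //; last exact: ltnW.
  by rewrite jm xpair_eqE -!val_eqE /=; lia.
(* Now [(j, i)] crosses both cuts, so the blocks have the same pair. Then [i] precedes [m] and [m]
   precedes [j], against [j] preceding [i]. *)
have kj1 : k < j by move: jm; rewrite -val_eqE /=; lia.
have := ji; rewrite pE' //; last exact: ltnW.
move=> /eqP[ii' jj']; rewrite -ii' -jj' in pE'.
have mi : covers p m i = false by rewrite pE // xpair_eqE eqxx eq_sym (negPf jm).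
have jm' : covers p j m = false.
  by rewrite pE' // xpair_eqE -val_eqE /=; lia.
have := ji; rewrite coversE; move: mi jm'; rewrite !coversE; lia.
Qed.

(** * Private inversions and the upper bound *)

Section PrivateInversions.

Variables (n : nat) (Q : {set 'S_n}).
Hypotheses (n_gt0 : 0 < n) (minQ : min_inversion_complete Q).
Implicit Types (p q : 'S_n) (u v : 'I_n * 'I_n) (x y z : 'I_n).

(** The smaller entry comes first: [u = (x, y)] encodes the inversion [(y, x)]. *)
Definition private p u :=
  [/\ u.1 < u.2, covers p u.2 u.1 &
      forall q, q \in Q -> covers q u.2 u.1 -> q = p].

Let complQ : inversion_complete Q. Proof. by case/andP: minQ. Qed.

Lemma complete_covers x y : x < y -> exists2 p, p \in Q & covers p y x.
Proof.
move=> xy; have /forallP/(_ x)/forallP/(_ y) := complQ.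
by rewrite xy => /exists_inP.
Qed.

(** By minimality [Q :\ p] misses some inversion; by completeness of [Q], it is [p] that covers
    it. *)
Lemma exists_private : exists f : 'S_n -> 'I_n * 'I_n,
  forall p, p \in Q -> private p (f p).
Proof.
suff priv p : exists u, p \in Q -> private p u by exact: fin_all_exists priv.
have [pQ | pQ] := boolP (p \in Q); last first.
  (* A dummy value for permutations outside [Q]. *)
  by exists (Ordinal n_gt0, Ordinal n_gt0).
have /andP[_ /forallP/(_ (Q :\ p))] := minQ.
rewrite properD1 //= => /forallPn[x /forallPn[y]].
rewrite negb_imply => /andP[xy /exists_inPn noq].
exists (x, y) => _; have only q : q \in Q -> covers q y x -> q = p.
  move=> qQ; apply: contraTeq => qp; apply: noq.
  by rewrite !inE qp.
split=> //=; have [q qQ qyx] := complete_covers xy.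
by rewrite -(only q).
Qed.

Section Choice.

Variable f : 'S_n -> 'I_n * 'I_n.
Hypothesis fP : forall p, p \in Q -> private p (f p).

Let P := f @: Q.

Let e x y := ((x, y) \in P) || ((y, x) \in P).

Lemma private_inj : {in Q &, injective f}.
Proof.
move=> p q pQ qQ fpq; have [_ _ only] := fP pQ; apply/esym/only => //.
by rewrite fpq; have [] := fP qQ.
Qed.

Let P_lt x y : (x, y) \in P -> x < y.
Proof. by case/imsetP => p pQ pE; have [] := fP pQ; rewrite -pE. Qed.

Let P_only p x y : p \in Q -> (x, y) \in P -> covers p y x = (f p == (x, y)).
Proof.
move=> pQ /imsetP[q qQ qE]; have [_ qyx only] := fP qQ; rewrite -qE in qyx only.
apply/idP/eqP => [/(only p pQ) -> // | pE].
by have [_ pyx _] := fP pQ; rewrite pE in pyx.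
Qed.

(** The owner of [(x, z)] covers neither of the other two inversions, so it has [x] before [y]
    before [z], yet it must place [z] before [x]. *)
Let no_triangle x y z : (x, y) \in P -> (y, z) \in P -> (x, z) \notin P.
Proof.
move=> xyP yzP; apply/negP => xzP; have /imsetP[p pQ pE] := xzP.
have xy := P_lt xyP; have yz := P_lt yzP.
have : covers p z x by rewrite P_only // pE.
have : ~~ covers p y x by rewrite P_only // -pE xpair_eqE -!val_eqE /=; lia.
have : ~~ covers p z y by rewrite P_only // -pE xpair_eqE -!val_eqE /=; lia.
rewrite !coversE; lia.
Qed.

Let e_sym : symmetric e.
Proof. by move=> x y; rewrite /e orbC. Qed.

Let e_triangle_free x y z : e x y -> e y z -> ~~ e x z.
Proof.
(* Of the eight orientations of a triangle, the two cyclic ones contradict the order; the other six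
   are instances of [no_triangle]. *)
move=> /orP[] xy /orP[] yz; apply/negP => /orP[] xz;
  have := P_lt xy; have := P_lt yz; have := P_lt xz; try lia.
- by have := no_triangle xy yz; rewrite xz.
- by have := no_triangle xz yz; rewrite xy.
- by have := no_triangle xz xy; rewrite ?yz.
- by have := no_triangle xy xz; rewrite ?yz.
- by have := no_triangle yz xz; rewrite ?xy.
- by have := no_triangle yz xy; rewrite ?xz.
Qed.

Let card_e : #|[set u | e u.1 u.2]| = 2 * #|Q|.
Proof.
pose swap u := (u.2, u.1); have swapK : involutive swap by case.
have -> : [set u | e u.1 u.2] = P :|: swap @: P.
  apply/setP => -[x y]; rewrite !inE /e /=; congr (_ || _).
  by rewrite (can_imset_pre _ swapK) inE.
have cardP : #|P| = #|Q| := card_in_imset private_inj.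
rewrite cardsU (card_imset _ (inv_inj swapK)) cardP.
have -> : P :&: swap @: P = set0; last by rewrite cards0; lia.
apply/setP => -[x y]; rewrite !inE (can_imset_pre _ swapK) inE /swap /=.
by apply: negbTE; apply/negP => /andP[/P_lt xy /P_lt]; lia.
Qed.

Lemma card_private_le : #|Q| <= n ^ 2 %/ 4.
Proof.
by have := mantel e_sym e_triangle_free; rewrite card_ord card_e => /(_ n_gt0); lia.
Qed.

(** * The extremal case: the bipartition is a cut *)

Let o : 'I_n := Ordinal n_gt0.

(** Suppose [y < x] with [x] in [N] and [y] outside. A second element [z] outside [N] gives a
    contradiction on either side of [x]. *)
Lemma bipartition_lt (N : {set 'I_n}) : o \in N -> 1 < #|~: N| ->
  (forall x y, x < y -> ((x, y) \in P) = ((x \in N) != (y \in N))) ->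
  forall x y, x \in N -> y \notin N -> x < y.
Proof.
move=> oN NC_gt1 PE.
have natural p x y : p \in Q -> x < y -> (x \in N) != (y \in N) ->
    f p != (x, y) -> covers p x y.
  move=> pQ xy xyN pxy; rewrite -coversN; first by rewrite P_only ?PE.
  by rewrite -val_eqE /= gtn_eqF.
move=> x y xN yN; rewrite ltnNge leq_eqVlt; apply/negP => /orP[yx | yx].
  by rewrite (val_inj (eqP yx)) xN in yN.
have oy : o < y.
  by rewrite lt0n; apply: contraNneq yN => y0; rewrite (_ : y = o) //; apply: val_inj.
have [z] : exists z, z \in ~: N :\ y.
  apply/set0Pn; rewrite -card_gt0; have := cardsD1 y (~: N); rewrite inE yN.
  by move: NC_gt1 => /[swap] ->.
rewrite !inE => /andP[zy zN].
have oz : o < z.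
  by rewrite lt0n; apply: contraNneq zN => z0; rewrite (_ : z = o) //; apply: val_inj.
have xz : x != z by apply: contraNneq zN => <-.
have ox := ltn_trans oy yx.
have oF (t : 'I_n) : o < t -> (o == t) = false by move=> ?; rewrite -val_eqE ltn_eqF.
have /orP[xltz | zltx] : (x < z) || (z < x) by rewrite -neq_ltn.
  (* For [x < z], the owner of [(o, z)] would contain the cycle [z], [o], [y], [x], [z] of
     precedences. *)
  have /imsetP[p pQ /esym pE] : (o, z) \in P by rewrite PE // oN zN.
  have c1 : covers p z o by have [_] := fP pQ; rewrite pE.
  have c2 : covers p o y.
    by apply: natural; rewrite ?oN ?yN // pE xpair_eqE eqxx.
  have c3 : covers p y x.
    by apply: natural; rewrite ?xN ?(negPf yN) // pE xpair_eqE oF.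
  have c4 : covers p x z.
    by apply: natural; rewrite ?xN ?(negPf zN) // pE xpair_eqE oF.
  by have := covers_trans (covers_trans c1 c2) (covers_trans c3 c4); rewrite coversE ltnn.
(* For [z < x], some [p] places [x] before [o]. For each [t] among [y] and [z], this inverts
   [(o, t)] or [(t, x)], which must then be the private pair of [p]; one pair cannot serve both
   values of [t]. *)
have [p pQ pxo] := complete_covers ox.
have via t : t \notin N -> o < t -> t < x -> (f p == (o, t)) || (f p == (t, x)).
  move=> tN ot tx; apply: contraTT pxo; rewrite negb_or => /andP[pot ptx].
  rewrite (coversF (b := x)) //.
  by apply: (covers_trans (y := t)); apply: natural; rewrite ?oN ?xN ?(negPf tN).
have := via z zN oz zltx; have := via y yN oy yx.
by case/orP => /eqP->; rewrite !xpair_eqE ![y == _]eq_sym (negPf zy) ?(oF z oz) ?(oF y oy) ?andbF.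
Qed.

Section Maximum.

Hypotheses (n_ge4 : 4 <= n) (maxQ : #|Q| = n ^ 2 %/ 4).

Let bipartition : exists N : {set 'I_n}, [/\ #|N| * #|~: N| = n ^ 2 %/ 4, o \in N &
  forall x y, x < y -> ((x, y) \in P) = ((x \in N) != (y \in N))].
Proof.
have [||N []] := mantel_eq e_sym e_triangle_free; rewrite ?card_ord ?card_e ?maxQ //.
move=> cardN eE.
have PE x y : x < y -> ((x, y) \in P) = ((x \in N) != (y \in N)).
  move=> xy; rewrite -eE /e; have [//|/= _] := boolP ((x, y) \in P).
  by apply/esym/negbTE/negP => /P_lt; lia.
have [oN | oN] := boolP (o \in N); first by exists N.
exists (~: N); rewrite setCK mulnC inE; split=> // x y xy.
by rewrite !inE PE //; case: (x \in N) (y \in N) => [] [].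
Qed.

Let bipartition_initial : exists k,
  [/\ k <= n, k * (n - k) = n ^ 2 %/ 4 & P = cross n k].
Proof.
have [N [cardN oN PE]] := bipartition.
have cardNC := cardsC N; rewrite card_ord in cardNC.
have NC_gt1 : 1 < #|~: N|.
  (* From [4 <= n] follows [n <= n ^ 2 %/ 4], while a complement with at most one element would give
     a product below [n]. *)
  have : n <= #|N| * #|~: N| by rewrite cardN leq_divRL // expnS expn1 leq_mul.
  by case: (#|~: N|) cardNC => [|[|//]]; lia.
have lt_N := bipartition_lt oN NC_gt1 PE.
(* An element [x] of [N] has all entries up to [x] in [N]; if [x] is outside, [N] consists of
   entries below [x]. *)
have NE x : (x \in N) = (x < #|N|).
  have [xN | xN] := boolP (x \in N).
    rewrite -(card_ord_lt (ltn_ord x)); apply/esym/subset_leq_card/subsetP => y.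
    by rewrite inE ltnS => yx; apply: contraTT yx => yN; rewrite -ltnNge lt_N.
  apply/esym/negbTE; rewrite -leqNgt -[leqRHS](card_ord_lt (ltnW (ltn_ord x))).
  by apply/subset_leq_card/subsetP => y yN; rewrite inE lt_N.
exists #|N|; split; [lia | by rewrite -cardN; congr (_ * _); lia |].
apply/setP => -[x y]; rewrite in_cross /=; have [xy | yx] := ltnP x y.
  by rewrite PE // !NE; case: (ltnP x #|N|); case: (ltnP y #|N|) => /=; lia.
have -> : ((x, y) \in P) = false by apply/negbTE/negP => /P_lt; lia.
by lia.
Qed.

(** Once the private pairs are exactly the pairs across the cut, [P_only] says that each [p] lies in
    the block of [f p], and privacy makes it the only member of [Q] there. *)
Lemma max_transversal : exists k,
  [/\ k <= n, k * (n - k) = n ^ 2 %/ 4 & Q \in transversals (blocks n k)].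
Proof.
have [k [kn kE PE]] := bipartition_initial; exists k; split=> //.
have Q_block p : p \in Q -> p \in block k (f p).1 (f p).2.
  move=> pQ; apply/blockP => a b ak kb.
  by rewrite P_only ?PE ?in_cross /= ?ak // -surjective_pairing eq_sym.
rewrite inE; apply/and3P; split; first exact: partition_blocks.
  apply/subsetP => p pQ; apply/bigcupP; exists (block k (f p).1 (f p).2).
    by apply: blocksP; rewrite -PE imset_f.
  exact: Q_block.
apply/forall_inP => _ /imsetP[u uC ->]; have uP := uC; rewrite -PE in uP.
case/imsetP: uP => p pQ uE; apply/cards1P; exists p; apply/setP => q.
rewrite in_setI in_set1; apply/andP/eqP => [[qQ] | ->]; last by rewrite uE Q_block.
rewrite in_cross in uC; case/andP: uC => u1 u2 /(block_covers u1 u2) qu.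
by have [_ _ only] := fP pQ; apply: only => //; rewrite -uE.
Qed.

End Maximum.
End Choice.
End PrivateInversions.

(** * The two halves of [n], the maximum and the extremal families *)

Lemma half_mul_half n : n %/ 2 * (n - n %/ 2) = n ^ 2 %/ 4.
Proof.
rewrite -[n in n ^ 2](odd_double_half n) -divn2 -muln2; set m := n %/ 2.
have : n = odd n + m * 2 by rewrite /m divn2 muln2 odd_double_half.
case: (odd n) => /= nE.
  rewrite (_ : (1 + m * 2) ^ 2 = (m * m.+1) * 4 + 1); last by nia.
  by rewrite divnMDl // addn0; congr (_ * _); lia.
rewrite (_ : (0 + m * 2) ^ 2 = (m * m) * 4); last by nia.
by rewrite mulnK //; congr (_ * _); lia.
Qed.

(** The numbers [k] and [n - k] have the same sum and product as the two halves of [n]. *)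
Lemma mul_compl_max n k : k <= n -> k * (n - k) = n ^ 2 %/ 4 ->
  k = n %/ 2 \/ k = n - n %/ 2.
Proof.
rewrite -half_mul_half; set m := n %/ 2; set l := n - m => kn kE.
have [lm | lm] : l = m \/ l = m.+1 by rewrite /l /m; lia.
  left; have : k + (n - k) = m + m by rewrite -{2}lm /l /m; lia.
  by rewrite lm in kE; nia.
have : k + (n - k) = m + m.+1 by rewrite -lm /l /m; lia.
rewrite lm in kE *; nia.
Qed.

Lemma gammaI_le n (Q : {set 'S_n}) : 0 < n -> min_inversion_complete Q ->
  #|Q| <= n ^ 2 %/ 4.
Proof.
by move=> n_gt0 minQ; have [f fP] := exists_private n_gt0 minQ; apply: card_private_le fP.
Qed.

(** The bound is attained by any transversal of the blocks for [k = n %/ 2], which has one member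
    per block. *)
Lemma gammaI_eq n : 2 <= n -> gammaI n = n ^ 2 %/ 4.
Proof.
move=> n_ge2; apply/eqP; rewrite eqn_leq; apply/andP; split.
  by apply/bigmax_leqP => Q; apply: gammaI_le; lia.
have [X trX] := transversals_blocks_inhabited n (n %/ 2).
rewrite -half_mul_half -(@card_blocks n) ?leq_div //.
rewrite -(card_transversal (X := X) (D := cover (blocks n (n %/ 2)))); last first.
  by rewrite inE in trX.
rewrite /gammaI (bigmax_sup X) //.
by apply: transversal_min_inversion_complete trX _; lia.
Qed.

Lemma Qstar_eq n : 4 <= n -> Qstar n =
  transversals (blocks n (n %/ 2)) :|: transversals (blocks n (n - n %/ 2)).
Proof.
move=> n_ge4; have n_ge2 : 2 <= n by lia.
have Qstar_tr k X : 0 < k < n -> k * (n - k) = n ^ 2 %/ 4 ->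
    X \in transversals (blocks n k) -> X \in Qstar n.
  move=> kn kE trX; rewrite inE (transversal_min_inversion_complete trX) //=.
  rewrite gammaI_eq // -kE -(@card_blocks n); last by lia.
  by rewrite (@card_transversal _ X (blocks n k) (cover (blocks n k))) //; rewrite inE in trX.
apply/setP => Q; rewrite in_setU; apply/idP/orP => [|[]]; last first.
- apply: Qstar_tr; first by lia.
  by rewrite subKn ?leq_div // mulnC half_mul_half.
- by apply: Qstar_tr (half_mul_half n); lia.
rewrite inE gammaI_eq // => /andP[minQ /eqP cardQ].
have n_gt0 : 0 < n by lia.
have [f fP] := exists_private n_gt0 minQ.
have [k [kn kE trQ]] := max_transversal n_gt0 minQ fP n_ge4 cardQ.
by case: (mul_compl_max kn kE) => <-; [left | right].
Qed.

Theorem theorem1 (n : nat) (hn : 2 <= n) :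
  (* (i) *)
  gammaI n = n ^ 2 %/ 4
  (* (ii) *)
  /\ (~~ odd n -> 4 <= n ->
      (exists F : {set {set 'S_n}},
         [/\ #|F| = n ^ 2 %/ 4,
             trivIset F,
             (forall B, B \in F -> #|B| = (n %/ 2 - 1)`! ^ 2) &
             Qstar n = transversals F])
      /\ #|Qstar n| = (n %/ 2 - 1)`! ^ (n ^ 2 %/ 2))
  (* (iii) *)
  /\ (odd n -> 5 <= n ->
      (exists F1 F2 : {set {set 'S_n}},
         [/\ #|F1| = n ^ 2 %/ 4 /\ #|F2| = n ^ 2 %/ 4,
             trivIset F1 /\ trivIset F2,
             (forall B, B \in F1 -> #|B| = (n %/ 2 - 1)`! * (n %/ 2)`!)
             /\ (forall B, B \in F2 -> #|B| = (n %/ 2 - 1)`! * (n %/ 2)`!),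
             Qstar n = transversals F1 :|: transversals F2 &
             [disjoint transversals F1 & transversals F2]])
      /\ #|Qstar n| = 2 * ((n %/ 2 - 1)`! * (n %/ 2)`!) ^ (n ^ 2 %/ 4)).
Proof.
split; first exact: gammaI_eq.
have cardF : #|blocks n (n %/ 2)| = n ^ 2 %/ 4.
  by rewrite card_blocks ?leq_div ?half_mul_half.
split=> [n_even n_ge4 | n_odd n_ge5].
  have halfE : n - n %/ 2 = n %/ 2 by lia.
  have QE : Qstar n = transversals (blocks n (n %/ 2)).
    by rewrite Qstar_eq // halfE setUid.
  have cardB B : B \in blocks n (n %/ 2) -> #|B| = (n %/ 2 - 1)`! ^ 2.
    by move/card_in_blocks->; rewrite halfE subn1 expnS expn1.
  split; first by exists (blocks n (n %/ 2)); split=> //; apply: trivIset_blocks.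
  rewrite QE (card_transversals 1%g _ (trivIset_blocks n _) cardB) ?expn_gt0 ?fact_gt0 //.
  rewrite cardF -expnM; congr (_ ^ _).
  (* Both quotients are exact for even [n], so twice [n ^ 2 %/ 4] is [n ^ 2 %/ 2]. *)
  have nE : n = n %/ 2 * 2 by lia.
  rewrite {1 2}nE expnMn -[2 ^ 2]/(2 * 2) mulnA mulnK //.
  by rewrite -mulnA mulnK // mulnC.
(* For odd [n] the two possible cuts are consecutive, so [transversals_blocksS_disjoint] applies. *)
have halfE : n - n %/ 2 = (n %/ 2).+1 by lia.
have cardF2 : #|blocks n (n %/ 2).+1| = n ^ 2 %/ 4.
  by rewrite -halfE card_blocks ?leq_subr // subKn ?leq_div // mulnC half_mul_half.
have QE : Qstar n = transversals (blocks n (n %/ 2)) :|: transversals (blocks n (n %/ 2).+1).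
  by rewrite Qstar_eq ?halfE //; lia.
have cardB1 B : B \in blocks n (n %/ 2) -> #|B| = (n %/ 2 - 1)`! * (n %/ 2)`!.
  by move/card_in_blocks->; rewrite halfE subn1.
have cardB2 B : B \in blocks n (n %/ 2).+1 -> #|B| = (n %/ 2 - 1)`! * (n %/ 2)`!.
  by move/card_in_blocks->; rewrite -halfE subKn ?leq_div // halfE subn1 mulnC.
have disj : [disjoint transversals (blocks n (n %/ 2)) & transversals (blocks n (n %/ 2).+1)].
  by apply: transversals_blocksS_disjoint; lia.
have tr1 := trivIset_blocks n (n %/ 2); have tr2 := trivIset_blocks n (n %/ 2).+1.
split; first by exists (blocks n (n %/ 2)), (blocks n (n %/ 2).+1).
have B_gt0 : 0 < (n %/ 2 - 1)`! * (n %/ 2)`! by rewrite muln_gt0 !fact_gt0.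
rewrite QE cardsU; have -> := disjoint_setI0 disj; rewrite cards0 subn0.
rewrite (card_transversals 1%g B_gt0 tr1 cardB1) (card_transversals 1%g B_gt0 tr2 cardB2).
by rewrite cardF cardF2 mul2n addnn.
Qed.
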